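(* Let $n\ge 2$, let $S$ be a semitransitive subsemigroup of $\mathcal{I}_n\setminus\mathcal{S}_n$, and let $p$ be the greatest proper divisor of $n$ (so $p=1$ if $n$ is prime). Then $|S|\ge 2n-p+1$.
   Context: $\mathcal{I}_n$ denotes the symmetric inverse semigroup of all partial injective maps of $X=\{1,\dots,n\}$ to itself (including the empty map). $\mathcal{S}_n$ is the symmetric group on $X$, so $\mathcal{I}_n\setminus\mathcal{S}_n$ consists of the non-invertible partial injections. A semigroup $S$ of partial transformations of $X$ is semitransitive if for all $x,y\in X$ there is $\varphi\in S$ with $x\varphi=y$ or $y\varphi=x$. A proper divisor of $n$ is a positive divisor different from $n$. *)

(* Defs.v *)
From mathcomp Require Import all_boot.
Set Implicit Arguments. Unset Strict Implicit. Unset Printing Implicit Defensive.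

(* X = {1,...,n} is modelled by 'I_n.  A partial transformation of X is a
   finite function 'I_n -> option 'I_n (None = undefined). *)
Definition ptrans (n : nat) := {ffun 'I_n -> option 'I_n}.

Definition is_pinj n (f : ptrans n) : bool :=
  [forall x, forall y, ((f x != None) && (f x == f y)) ==> (x == y)].

(* total (defined everywhere); a total partial injection is a permutation *)
Definition is_total n (f : ptrans n) : bool := [forall x, f x != None].

Definition noninv_pinj n (f : ptrans n) : bool := is_pinj f && ~~ is_total f.

(* composition written on the right: x (f g) = (x f) g *)
Definition pcomp n (f g : ptrans n) : ptrans n := [ffun x => obind g (f x)].

Definition subsemigroup_of_noninv n (S : {set ptrans n}) : Prop :=
  (forall f, f \in S -> noninv_pinj f) /\
  (forall f g, f \in S -> g \in S -> pcomp f g \in S).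

Definition semitransitive n (S : {set ptrans n}) : Prop :=
  forall x y : 'I_n, exists2 f, f \in S & (f x = Some y \/ f y = Some x).

Definition greatest_proper_divisor (n : nat) : nat :=
  \max_(d < n | d %| n) d.

(* Main.v *)
(** For a point x let core x be the least set A with x in A whose partial
identity lies in S.  Semitransitivity makes "some element of S maps x to y" a
total preorder; let C_0 > C_1 > ... > C_{m-1} be its classes, which we call levels.

If the core is not constant on some class, take the highest such class and two
of its points with different cores: the elements joining these two points to
each of the n points are 2n distinct elements of S.

Otherwise each level i has a core, and the elements of S permuting it act
transitively on C_i.  Composing steps C_i -> C_{i+1} -> ... -> C_{i+d} and
saturating under the permutations at both ends gives a set of elements of S
whose size is a positive common multiple of |C_i| and |C_{i+d}|, and two such
sets meet only if the sequences of cores of the two windows coincide.  As S has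
no total element, two consecutive levels have different cores; growing a segment
of levels from this pair, each new level brings two new windows.  Counting gives
2n - g nonzero elements, where g divides all |C_i|, hence g is a proper divisor
of n; the empty map is one more element. *)

From mathcomp Require Import all_boot all_fingroup.
From mathcomp Require Import zify.
Require Import Defs.
Set Implicit Arguments. Unset Strict Implicit. Unset Printing Implicit Defensive.

(** * Two inequalities on common multiples *)

(** Either [w] is one of [a] and [b], and then the other divides it and is the gcd, or [w] is at
    least twice each of them. *)
Lemma common_multiple_gcd_ge a b w :
  0 < w -> a %| w -> b %| w -> a + b <= w + gcdn a b.
Proof.
move=> w0 /dvdnP[p wp] /dvdnP[q wq].
have [p1|p2] : p = 1 \/ 2 <= p by nia.
  have ba : b %| a by apply/dvdnP; exists q; lia.
  by have := gcdn_idPr ba; lia.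
have [q1|q2] : q = 1 \/ 2 <= q by nia.
  have ab : a %| b by apply/dvdnP; exists p; lia.
  by have := gcdn_idPl ab; lia.
have a2 : 2 * a <= w by rewrite wp leq_mul2r p2 orbT.
have b2 : 2 * b <= w by rewrite wq leq_mul2r q2 orbT.
by apply: leq_trans (leq_addr _ _); lia.
Qed.

(** If [b] divides [a], the gcd is [b]. Otherwise neither [w] nor [w'] can be [a] itself, so
    [2 * a <= w'], while [b <= w]. *)
Lemma common_multiples_gcd_ge a b w w' :
  0 < w -> 0 < w' -> a %| w -> a %| w' -> b %| w -> b %| w' ->
  2 * a + b <= w + w' + gcdn a b.
Proof.
move=> w0 w'0 aw aw' bw bw'.
have [ba|nba] := boolP (b %| a).
  rewrite (gcdn_idPr ba) leq_add2r mulSn mul1n.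
  by apply: leq_add; apply: dvdn_leq.
have /dvdnP[p wp] := aw; have /dvdnP[p' wp'] := aw'.
have p2 : 2 <= p by case: p wp => [|[|p]] wp //; rewrite wp ?mul1n // in w0 bw; rewrite bw in nba.
have p'2 : 2 <= p'.
  by case: p' wp' => [|[|p']] wp' //; rewrite wp' ?mul1n // in w'0 bw'; rewrite bw' in nba.
have a2 : 2 * a <= w by rewrite wp leq_mul2r p2 orbT.
have a2' : 2 * a <= w' by rewrite wp' leq_mul2r p'2 orbT.
apply: leq_trans (leq_addr _ _).
by move: (dvdn_leq w0 bw) a2 a2'; clear; lia.
Qed.

(** * Comparing two windows through trajectories in both directions *)

Section Trajectories.

Variables (T : finType) (A : nat -> {set T}).

(* [phi] records the levels visited by a point carried through the [d] steps of the
   window starting at level [i]; [A] gives the cores of the levels. *)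
Definition trajectory i d k l (phi : nat -> nat) :=
  [/\ phi 0 = k, phi d = l, forall s, s < d -> phi s <= phi s.+1,
      forall s, s <= d -> A (phi s) \subset A (i + s)
    & forall s, s < d -> phi s = phi s.+1 ->
        A (phi s) <> A (i + s) /\ A (phi s) <> A (i + s.+1)].

Lemma trajectory_mono i d k l phi s t :
  trajectory i d k l phi -> s <= t -> t <= d -> phi s <= phi t.
Proof.
case=> _ _ mono _ _; elim: t => [|t IH]; first by rewrite leqn0 => /eqP->.
rewrite leq_eqVlt => /orP[/eqP->//|st td].
by apply: leq_trans (mono t td); apply: IH => //; apply: ltnW.
Qed.

(* At a fixed point [s] of [fun s => psi (phi s - j) - i] the two cores agree, so
   neither [phi] nor [psi] may stall there; this pushes the lower bound one step to
   the right, and symmetrically the upper bound one step to the left. *)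
Lemma trajectory_inverse i d j e phi psi s :
  trajectory i d j (j + e) phi -> trajectory j e i (i + d) psi -> s <= d ->
  psi (phi s - j) = i + s.
Proof.
move=> tphi tpsi.
have [phi0 phid phim phiA phis] := tphi; have [psi0 psie psim psiA psis] := tpsi.
have phi_ge t : t <= d -> j <= phi t.
  by move=> td; rewrite -phi0; apply: trajectory_mono tphi _ td.
have phi_le t : t <= d -> phi t <= j + e.
  by move=> td; rewrite -phid; apply: trajectory_mono tphi td _.
have fixed t : t <= d -> psi (phi t - j) = i + t -> A (phi t) = A (i + t).
  move=> td E; apply/eqP; rewrite eqEsubset phiA //= -E.
  have {2}-> : phi t = j + (phi t - j) by have := phi_ge t td; lia.
  by apply: psiA; have := phi_le t td; lia.
have lower : forall t, t <= d -> i + t <= psi (phi t - j).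
  elim=> [|t IH] td; first by rewrite phi0 subnn psi0 addn0.
  have le1 := IH (ltnW td); have ge := phi_ge t (ltnW td).
  have le' := phi_le _ td; have mo := phim t td.
  have [E|lt1] : psi (phi t - j) = i + t \/ i + t < psi (phi t - j) by lia.
    have At := fixed t (ltnW td) E.
    have lt2 : phi t < phi t.+1.
      by rewrite ltn_neqAle mo andbT; apply/eqP => st; case: (phis t td st).
    have [te tle] : phi t - j < e /\ (phi t - j).+1 <= phi t.+1 - j by lia.
    have mo' : psi (phi t - j).+1 <= psi (phi t.+1 - j).
      by apply: trajectory_mono tpsi tle _; lia.
    have le3 := psim _ te.
    have ne : psi (phi t - j) <> psi (phi t - j).+1.
      move=> st; case: (psis _ te st) => + _; apply.
      by rewrite E -At; congr A; lia.
    by lia.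
  have mo' : psi (phi t - j) <= psi (phi t.+1 - j).
    by apply: trajectory_mono tpsi _ _; lia.
  by lia.
have upper : forall r, r <= d -> psi (phi (d - r) - j) <= i + (d - r).
  elim=> [|r IH] rd; first by rewrite subn0 phid addKn psie.
  move: (IH (ltnW rd)); set t := d - r.+1.
  have -> : d - r = t.+1 by lia.
  have td : t < d by lia.
  have ge := phi_ge t (ltnW td).
  have le' := phi_le _ td; have mo := phim t td.
  have mo' : psi (phi t - j) <= psi (phi t.+1 - j).
    by apply: trajectory_mono tpsi _ _; lia.
  move=> le1; rewrite leqNgt; apply/negP => gt1.
  have E : psi (phi t.+1 - j) = i + t.+1 by lia.
  have At := fixed t.+1 td E.
  have lt2 : phi t < phi t.+1.
    rewrite ltn_neqAle mo andbT; apply/eqP => st; case: (phis t td st) => _; apply.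
    by rewrite st.
  have [u Eu] : exists u, phi t.+1 - j = u.+1 by exists (phi t.+1 - j).-1; lia.
  have ue : u < e by lia.
  have mo1 : psi (phi t - j) <= psi u by apply: trajectory_mono tpsi _ _; lia.
  have mo2 := psim u ue; rewrite Eu in E.
  have st : psi u = psi u.+1 by lia.
  case: (psis u ue st) => _; apply; rewrite st E -At; congr A; lia.
move=> sd; apply/eqP; rewrite eqn_leq lower // andbT.
by have := upper (d - s) (leq_subr _ _); rewrite subKn.
Qed.

(** A stall of [phi] at [s] would make [trajectory_inverse] equate [i + s] with [i + s.+1]. *)
Lemma trajectory_strict i d j e phi psi s :
  trajectory i d j (j + e) phi -> trajectory j e i (i + d) psi ->
  s < d -> phi s < phi s.+1.
Proof.
move=> tphi tpsi sd; have [_ _ + _ _] := tphi => /(_ s sd).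
rewrite leq_eqVlt => /orP[/eqP E|//].
have := trajectory_inverse tphi tpsi (ltnW sd).
have := trajectory_inverse tphi tpsi sd.
by rewrite E; lia.
Qed.

Lemma trajectory_length i d j e phi psi :
  trajectory i d j (j + e) phi -> trajectory j e i (i + d) psi ->
  d <= e /\ forall s, s <= d -> j + s <= phi s.
Proof.
move=> tphi tpsi; have [phi0 phid _ _ _] := tphi.
have ge s : s <= d -> j + s <= phi s.
  elim: s => [|s IH] sd; first by rewrite phi0 addn0.
  by have := trajectory_strict tphi tpsi sd; have := IH (ltnW sd); lia.
by split=> //; have := ge d (leqnn d); rewrite phid; lia.
Qed.

(** Strict growth both ways forces [d = e] and [phi s = j + s]. The core inclusions along [phi] and
    along [psi] are then opposite to each other. *)
Lemma trajectory_eq i d j e phi psi :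
  trajectory i d j (j + e) phi -> trajectory j e i (i + d) psi ->
  d = e /\ forall s, s <= d -> A (i + s) = A (j + s).
Proof.
move=> tphi tpsi; have [de ge] := trajectory_length tphi tpsi.
have [ed ge'] := trajectory_length tpsi tphi.
have E : d = e by lia.
split=> // s sd.
have inv := trajectory_inverse tphi tpsi sd.
have [_ phid _ phiA _] := tphi; have [_ _ _ psiA _] := tpsi.
have up : forall r, r <= d -> phi (d - r) <= j + (d - r).
  elim=> [|r IH] rd; first by rewrite subn0 phid; lia.
  have lt : d - r.+1 < d by lia.
  have := trajectory_strict tphi tpsi lt; have := IH (ltnW rd).
  have -> : (d - r.+1).+1 = d - r by lia. lia.
have phis : phi s = j + s.
  by have := up (d - s) (leq_subr _ _); rewrite subKn //; have := ge s sd; lia.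
apply/eqP; rewrite eqEsubset; apply/andP; split.
  by have := psiA s; rewrite -inv phis addKn; apply; lia.
by have := phiA s sd; rewrite phis.
Qed.

End Trajectories.

(** * Orbit counting and permutations acting on partial maps *)

(** [F] splits into orbits whose sizes are indices of stabilisers. A stabiliser contained in that of
    a point in the orbit of [y] has index divisible by the size of that orbit. *)
Lemma card_orbit_dvdn (gT : finGroupType) (T T' : finType) (G : {group gT})
    (to : {action gT &-> T}) (to' : {action gT &-> T'}) (F : {set T}) (y : T') :
  [acts G, on F | to] ->
  (forall x, x \in F -> exists2 z, z \in orbit to' G y &
     'C_G[x | to] \subset 'C_G[z | to'])%g ->
  #|orbit to' G y| %| #|F|.
Proof.
move=> actF stabF; rewrite -(acts_sum_card_orbit actF).
apply: (big_ind (fun k => #|orbit to' G y| %| k)) => [|a b|_ /imsetP[x xF ->]].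
- exact: dvdn0.
- exact: dvdn_add.
have [z /orbit_eqP yz sxz] := stabF x xF.
rewrite -yz !card_orbit -(Lagrange_index (subsetIl _ _) sxz).
exact: dvdn_mulr.
Qed.

Section PermutationActions.

Variable n : nat.
Implicit Types (f : ptrans n) (s : {perm 'I_n}).

(** The inverse makes precomposition a right action. *)
Definition lperm f s : ptrans n := [ffun x => f (s^-1%g x)].

Definition rperm f s : ptrans n := [ffun x => omap s (f x)].

Lemma lpermE f s x : lperm f s x = f (s^-1%g x).
Proof. exact: ffunE. Qed.

Lemma rpermE f s x : rperm f s x = omap s (f x).
Proof. exact: ffunE. Qed.

Lemma lperm1 f : lperm f 1%g = f.
Proof. by apply/ffunP => x; rewrite lpermE invg1 perm1. Qed.

Lemma lpermM f s t : lperm f (s * t)%g = lperm (lperm f s) t.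
Proof. by apply/ffunP => x; rewrite !lpermE invMg permM. Qed.

Lemma rperm1 f : rperm f 1%g = f.
Proof. by apply/ffunP => x; rewrite rpermE; case: (f x) => //= y; rewrite perm1. Qed.

Lemma rpermM f s t : rperm f (s * t)%g = rperm (rperm f s) t.
Proof. by apply/ffunP => x; rewrite !rpermE; case: (f x) => //= y; rewrite permM. Qed.

Lemma lrpermC f s t : lperm (rperm f t) s = rperm (lperm f s) t.
Proof. by apply/ffunP => x; rewrite !(lpermE, rpermE). Qed.

Canonical lperm_action := TotalAction lperm1 lpermM.
Canonical rperm_action := TotalAction rperm1 rpermM.

Definition prestr (A : {set 'I_n}) s : ptrans n :=
  [ffun x => if x \in A then Some (s x) else None].

Lemma prestrE A s x : prestr A s x = if x \in A then Some (s x) else None.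
Proof. exact: ffunE. Qed.

End PermutationActions.

(** * Partial identities and idempotent powers *)

Section PartialMaps.

Variable n : nat.
Implicit Types (f g h : ptrans n) (A B : {set 'I_n}).

Lemma pcompE f g x : pcomp f g x = obind g (f x).
Proof. exact: ffunE. Qed.

Lemma pcompA f g h : pcomp f (pcomp g h) = pcomp (pcomp f g) h.
Proof. by apply/ffunP => x; rewrite !pcompE; case: (f x) => //= y; rewrite pcompE. Qed.

Lemma pcomp_SomeP f g x y :
  pcomp f g x = Some y <-> exists2 z, f x = Some z & g z = Some y.
Proof.
rewrite pcompE; case: (f x) => [z|] /=; split => //.
- by exists z.
- by case=> _ [<-].
- by case.
Qed.

Definition pid A : ptrans n := [ffun x => if x \in A then Some x else None].

Lemma pidE A x : pid A x = if x \in A then Some x else None.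
Proof. exact: ffunE. Qed.

Lemma pid_SomeP A x y : pid A x = Some y <-> x \in A /\ y = x.
Proof.
rewrite pidE; case: ifP => _; split=> //.
- by case.
- by case=> _ ->.
- by case.
Qed.

Lemma pid_comp A B : pcomp (pid A) (pid B) = pid (A :&: B).
Proof.
by apply/ffunP => x; rewrite pcompE !pidE inE; case: (x \in A) => //=; rewrite pidE.
Qed.

Lemma pinj_inj f x y z : is_pinj f -> f x = Some z -> f y = Some z -> x = y.
Proof.
by move=> /forallP/(_ x)/forallP/(_ y)/implyP fi fx fy; apply/eqP/fi; rewrite fx fy eqxx.
Qed.

Lemma pinj_idem f : is_pinj f -> pcomp f f = f -> f = pid [set x | f x == Some x].
Proof.
move=> fi ff; apply/ffunP => x; rewrite pidE inE.
case: eqP => [-> //|]; case E: (f x) => [y|] // fx; case: fx.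
have /pcomp_SomeP[z] : pcomp f f x = Some y by rewrite ff.
by rewrite E => -[<-] fy; rewrite (pinj_inj fi E fy).
Qed.

(** The exponent is [k + 1], so that every [ppow f k] stays in a semigroup containing [f]. *)
Definition ppow f k : ptrans n := iter k (pcomp f) f.

Lemma ppowD f i j : pcomp (ppow f i) (ppow f j) = ppow f (i + j).+1.
Proof. by elim: i => // i IH; rewrite /= -pcompA IH. Qed.

Lemma ppow_idem f : exists k, pcomp (ppow f k) (ppow f k) = ppow f k.
Proof.
pose F (i : 'I_(#|{: ptrans n}|.+1)) := ppow f i.
have /injectivePn[i0 [j0 ij Fij]] : ~~ injectiveb F.
  by apply/injectiveP => /leq_card; rewrite card_ord ltnn.
wlog lt_ij : i0 j0 ij Fij / i0 < j0.
  move=> W; case: (ltngtP i0 j0) => [|| /val_inj /eqP]; last by rewrite (negPf ij).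
    exact: W.
  by apply: W => //; rewrite eq_sym.
move: Fij; rewrite /F; move: lt_ij; move: (val i0) (val j0) => /= i j lt_ij eij.
pose d := j - i.
have per a : i <= a -> ppow f (a + d) = ppow f a.
  rewrite leq_eqVlt => /orP[/eqP<-|lt_ia]; first by rewrite /d subnKC // ltnW.
  have -> : a + d = ((a - i.+1) + j).+1 by lia.
  by rewrite -ppowD -eij ppowD; congr ppow; lia.
have perM a c : i <= a -> ppow f (a + d * c) = ppow f a.
  move=> ia; elim: c => [|c IH]; first by rewrite muln0 addn0.
  by rewrite mulnS addnCA addnC per ?IH //; lia.
(* The true exponent is [d * i.+1], a multiple of the period [d] lying in the periodic range;
   doubling it adds a whole number of periods. *)
exists (d * i.+1).-1; rewrite ppowD.
have d0 : 0 < d by lia.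
have -> : ((d * i.+1).-1 + (d * i.+1).-1).+1 = (d * i.+1).-1 + d * i.+1 by nia.
by apply: perM; nia.
Qed.

End PartialMaps.

(** * Reachability and cores *)

Section Semigroup.

Variables (n : nat) (S : {set ptrans n}).
Hypothesis Ssg : subsemigroup_of_noninv S.
Hypothesis Sst : semitransitive S.
Implicit Types (f g h : ptrans n) (A B : {set 'I_n}).

Lemma Smul f g : f \in S -> g \in S -> pcomp f g \in S.
Proof. by case: Ssg => _; apply. Qed.

Lemma Sinj f x y z : f \in S -> f x = Some z -> f y = Some z -> x = y.
Proof. by case: Ssg => + _ fS => /(_ f fS)/andP[fi _]; apply: pinj_inj fi. Qed.

Lemma pid_setT_notin : pid [set: 'I_n] \notin S.
Proof.
apply/negP; case: Ssg => + _ => /[apply] /andP[_ /negP]; apply.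
by apply/forallP => x; rewrite pidE inE.
Qed.

Definition reach : rel 'I_n := fun x y => [exists f in S, f x == Some y].

Lemma reachP x y : reflect (exists2 f, f \in S & f x = Some y) (reach x y).
Proof.
apply: (iffP existsP) => [[f /andP[fS /eqP]]|[f fS fx]]; exists f => //.
by rewrite fS fx eqxx.
Qed.

Lemma reach_refl x : reach x x.
Proof. by apply/reachP; case: (Sst x x) => f fS fx; exists f => //; case: fx. Qed.

Lemma reach_trans y x z : reach x y -> reach y z -> reach x z.
Proof.
move=> /reachP[f fS fx] /reachP[g gS gy]; apply/reachP; exists (pcomp f g); first exact: Smul.
by apply/pcomp_SomeP; exists y.
Qed.

Lemma reach_total x y : reach x y || reach y x.
Proof. by apply/orP; case: (Sst x y) => f fS [] ?; [left|right]; apply/reachP; exists f. Qed.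

Lemma ppow_S f k : f \in S -> ppow f k \in S.
Proof. by move=> fS; elim: k => // k IH; apply: Smul. Qed.

(** [pid B] is the idempotent power of [h], so [B] consists of points on cycles of [h], and further
    powers bring [h w] back to [w]. *)
Lemma idempotent_power h : h \in S ->
  exists B, [/\ pid B \in S, forall x, h x = Some x -> x \in B
    & forall w, w \in B -> exists2 v, h w = Some v & reach v w].
Proof.
move=> hS; have [k kk] := ppow_idem h.
have kS := ppow_S k hS.
have hi : is_pinj (ppow h k) by case: Ssg => + _ => /(_ _ kS)/andP[].
have e := pinj_idem hi kk; exists [set x | ppow h k x == Some x].
split=> [|x hx|w]; first by rewrite -e.
  by rewrite inE; elim: (k) => [|j IH]; rewrite /= ?hx // pcompE hx /=.
(* Squaring the idempotent leaves a positive power of [h] after one factor [h] is split off. *)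
rewrite inE -{1}kk ppowD /= => /eqP/pcomp_SomeP[v hw pv].
by exists v => //; apply/reachP; exists (ppow h (k + k)) => //; apply: ppow_S.
Qed.

Definition core x : {set 'I_n} :=
  [set y | [forall B : {set 'I_n}, (pid B \in S) && (x \in B) ==> (y \in B)]].

Lemma core_min x B : pid B \in S -> x \in B -> core x \subset B.
Proof.
move=> BS xB; apply/subsetP => y; rewrite inE => /forallP/(_ B)/implyP; apply.
by rewrite BS.
Qed.

Lemma core_id x : x \in core x.
Proof. by rewrite inE; apply/forallP => B; apply/implyP => /andP[]. Qed.

(** Partial identities multiply by intersecting domains, so a domain of least size around [x] lies
    inside all the others. One exists by taking the idempotent power of an element fixing [x]. *)
Lemma pid_core x : pid (core x) \in S.
Proof.
have /reachP[f fS fx] := reach_refl x.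
have [B0 [B0S /(_ _ fx) xB0 _]] := idempotent_power fS.
have PB0 : (pid B0 \in S) && (x \in B0) by rewrite B0S.
case: (arg_minnP (P := fun B => (pid B \in S) && (x \in B)) (fun B => #|B|) PB0).
move=> B /andP[BS xB] Bmin; suff -> : core x = B by [].
apply/eqP; rewrite eqEsubset core_min //; apply/subsetP => y yB.
rewrite inE; apply/forallP => D; apply/implyP => /andP[DS xD].
have /eqP BD : B :&: D == B.
  by rewrite eqEcard subsetIl Bmin // inE xB xD -pid_comp Smul.
by rewrite -BD in yB; case/setIP: yB.
Qed.

Lemma core_sub x y : y \in core x -> core y \subset core x.
Proof. by apply: core_min; apply: pid_core. Qed.

Lemma core_eq x y : x \in core y -> y \in core x -> core x = core y.
Proof. by move=> xy yx; apply/eqP; rewrite eqEsubset !core_sub. Qed.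

(** Multiplying by the partial identities of both cores confines the element to them; when two such
    elements coincide, this puts the endpoints of one into the cores of the other. *)
Lemma reach_core x y : reach x y ->
  exists f, [/\ f \in S, f x = Some y
    & forall w v, f w = Some v -> w \in core x /\ v \in core y].
Proof.
move=> /reachP[f fS fx]; exists (pcomp (pcomp (pid (core x)) f) (pid (core y))).
split; first by rewrite !Smul ?pid_core.
  apply/pcomp_SomeP; exists y; last by apply/pid_SomeP; rewrite core_id.
  by apply/pcomp_SomeP; exists x => //; apply/pid_SomeP; rewrite core_id.
move=> w v /pcomp_SomeP[z /pcomp_SomeP[u /pid_SomeP[wx _] _] /pid_SomeP[zy ->]].
by [].
Qed.

(** Going to [y] by [f], cutting to [core y] and returning by [g] fixes [x]. The domain of the
    idempotent power therefore contains all of [core x], whose points must survive the cut and can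
    be brought back. *)
Lemma recurrent_core f x y w : f \in S -> f x = Some y -> reach y x -> w \in core x ->
  exists v, [/\ f w = Some v, v \in core y & reach v w].
Proof.
move=> fS fx /reachP[g gS gy] wx.
pose h := pcomp (pcomp f (pid (core y))) g.
have hS : h \in S by rewrite !Smul ?pid_core.
have hx : h x = Some x.
  apply/pcomp_SomeP; exists y => //; apply/pcomp_SomeP; exists y => //.
  by apply/pid_SomeP; rewrite core_id.
have [B [BS /(_ _ hx) xB Bw]] := idempotent_power hS.
have [u /pcomp_SomeP[v /pcomp_SomeP[v' fw /pid_SomeP[vy ev]] gv] uw] :=
  Bw w (subsetP (core_min BS xB) _ wx).
rewrite {}ev in gv; exists v'; split => //.
by apply: reach_trans uw; apply/reachP; exists g.
Qed.

Lemma recurrent_image f x y : f \in S -> f x = Some y -> reach y x ->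
  #|core x| <= #|core y| /\ (#|core x| = #|core y| ->
    forall v, v \in core y -> exists2 w, w \in core x & f w = Some v).
Proof.
move=> fS fx yx; pose F w := odflt w (f w).
have FE w : w \in core x -> f w = Some (F w).
  by move=> /(recurrent_core fS fx yx)[v [fw _ _]]; rewrite /F fw.
have Fi : {in core x &, injective F}.
  by move=> w w' wx w'x E; apply: (Sinj fS (FE _ wx)); rewrite E; apply: FE.
have sF : F @: core x \subset core y.
  apply/subsetP => _ /imsetP[w wx ->].
  by have [v [fw vy _]] := recurrent_core fS fx yx wx; rewrite /F fw.
have cF := card_in_imset Fi.
split; first by rewrite -cF subset_leq_card.
move=> E v; have <- : F @: core x = core y by apply/eqP; rewrite eqEcard sF cF E /=.
by case/imsetP => w wx ->; exists w => //; apply: FE.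
Qed.

Lemma card_core x y : reach x y -> reach y x -> #|core x| = #|core y|.
Proof.
move=> xy yx; apply/eqP; rewrite eqn_leq; apply/andP; split.
  by have /reachP[f fS fx] := xy; case: (recurrent_image fS fx yx).
by have /reachP[f fS fx] := yx; case: (recurrent_image fS fx xy).
Qed.

(* A nonempty domain of least size among the partial identities of S would be
   permuted by all of S, and so cut off from its complement. *)
Lemma pid0_in (n_gt1 : 1 < n) : pid set0 \in S.
Proof.
pose x0 : 'I_n := Ordinal (ltnW n_gt1).
case: (arg_minnP (P := fun B => pid B \in S) (fun B => #|B|) (pid_core x0)) => A AS Amin.
have [A0|[w wA]] := set_0Vmem A; first by rewrite A0 in AS.
have stab s : s \in S -> forall v, v \in A -> exists2 u, u \in A & s v = Some u.
  move=> sS v vA; pose h := pcomp (pcomp (pid A) s) (pid A).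
  have hA u u' : h u = Some u' -> u \in A /\ exists2 u', u' \in A & s u = Some u'.
    move=> /pcomp_SomeP[z /pcomp_SomeP[t /pid_SomeP[uA ->] su] /pid_SomeP[zA _]].
    by split=> //; exists z.
  have [|B [BS _ Bh]] := @idempotent_power h; first by rewrite !Smul.
  have sBA : B \subset A by apply/subsetP => u /Bh[u' /hA[]].
  have BA : B = A by apply/eqP; rewrite eqEcard sBA Amin.
  by rewrite -BA in vA; have [u /hA[]] := Bh v vA.
have [x xA] : exists x, x \notin A.
  apply/existsP; rewrite -negb_forall; apply/negP => /forallP AT.
  have {}AT : A = setT by apply/setP => x; rewrite AT inE.
  by rewrite AT (negPf pid_setT_notin) in AS.
have [f fS [fw|fx]] := Sst w x.
  by have [u uA] := stab f fS w wA; rewrite fw => -[E]; rewrite E uA in xA.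
pose F v := odflt v (f v).
have FE v : v \in A -> f v = Some (F v) by move=> /(stab f fS)[u _ fv]; rewrite /F fv.
have Fi : {in A &, injective F}.
  by move=> v v' vA v'A E; apply: (Sinj fS (FE _ vA)); rewrite E; apply: FE.
have FA : F @: A = A.
  apply/eqP; rewrite eqEcard card_in_imset // leqnn andbT.
  apply/subsetP => _ /imsetP[v vA ->]; have [u uA fv] := stab f fS v vA.
  by rewrite /F fv.
(* [f] permutes [A], so [w] already has a preimage in [A], which by injectivity is [x]. *)
move: wA; rewrite -{1}FA => /imsetP[v vA wv].
by case/negP: xA; rewrite (Sinj fS fx (y := v)) // wv FE.
Qed.

(** * A class on which the core is not constant *)

Definition communicate x y := reach x y && reach y x.

(** Constancy of the core passes from the class of [w] to that of [u]: an element taking [u] to [u']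
    moves [w] inside its class to some [v] in [core u'], and [core v = core u] already has the size
    of [core u']. *)
Lemma core_communicate_sub w u u' :
  (forall v, communicate w v -> core v = core w) ->
  core w = core u -> communicate u u' -> core u' = core u.
Proof.
move=> wc wu /andP[uu' u'u]; have /reachP[f fS fu] := uu'.
have wcu : w \in core u by rewrite -wu core_id.
have [v [fw vu' vw]] := recurrent_core fS fu u'u wcu.
have wv : core v = core w.
  by apply: wc; rewrite /communicate vw andbT; apply/reachP; exists f.
apply/esym/eqP; rewrite eqEcard -wu -wv core_sub //.
by rewrite wv wu (card_core uu' u'u) leqnn.
Qed.

Lemma card_core_nonconstant x0 y0 : communicate x0 y0 -> core y0 != core x0 -> 2 * n <= #|S|.
Proof.
move=> cxy0 ne0; pose bad x := [exists y, communicate x y && (core y != core x)].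
have bx0 : bad x0 by apply/existsP; exists y0; rewrite cxy0.
(* The highest bad class is the one whose points reach the most points. *)
case: (arg_maxnP (P := bad) (fun x => #|[set y | reach x y]|) bx0) => x bx xmax.
have badr w : bad w -> reach x w.
  move=> bw; case: (boolP (reach x w)) => // nxw.
  have wx : reach w x by have := reach_total w x; rewrite (negPf nxw) orbF.
  have : #|[set y | reach w y]| <= #|[set y | reach x y]| := xmax w bw.
  rewrite leqNgt => /negP[]; apply: proper_card.
  apply/properP; split; first by apply/subsetP => y; rewrite !inE; apply: reach_trans.
  by exists w; rewrite !inE ?reach_refl.
have /existsP[x' /andP[/andP[xx' x'x] ne]] := bx.
pose xb (b : bool) := if b then x else x'.
have rxb b : reach x (xb b) by case: b; rewrite //= reach_refl.
have rbx b : reach (xb b) x by case: b; rewrite //= reach_refl.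
have neb b b' : xb b \in core (xb b') -> xb b' \in core (xb b) -> b = b'.
  move=> i j; have := core_eq i j.
  by case: b b' {i j} => [] [] //= E; rewrite E eqxx in ne.
have badb b : bad (xb b).
  case: b => //=; apply/existsP; exists x; rewrite eq_sym ne.
  by rewrite /communicate xx' x'x.
have /fin_all_exists[F FP] : forall p : 'I_n * bool, exists f, [/\ f \in S,
    reach x p.1 -> f (xb p.2) = Some p.1 /\
      (forall w v, f w = Some v -> w \in core (xb p.2) /\ v \in core p.1)
  & ~~ reach x p.1 -> f p.1 = Some (xb p.2) /\
      (forall w v, f w = Some v -> w \in core p.1 /\ v \in core (xb p.2))].
  case=> y b /=; case: (boolP (reach x y)) => [xy|nxy].
    by have [f [fS fb fc]] := reach_core (reach_trans (rbx b) xy); exists f.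
  have yx : reach y x by have := reach_total y x; rewrite (negPf nxy) orbF.
  by have [f [fS fb fc]] := reach_core (reach_trans yx (rxb b)); exists f.
(* A coincidence would give [w] and [xb b] the same core. As [x] does not reach [w], the class of
   [w] is not bad, so that of [xb b] would not be bad either. *)
have mixed y b w b' : reach x y -> ~~ reach x w -> F (y, b) <> F (w, b').
  move=> xy nxw E.
  have [_ /(_ xy) /= [Fb Fc] _] := FP (y, b).
  have [_ _ /(_ nxw) /= [Fw Fd]] := FP (w, b').
  rewrite -E in Fw Fd; have [wb _] := Fc _ _ Fw; have [bw _] := Fd _ _ Fb.
  have wE := core_eq wb bw.
  have wgood v : communicate w v -> core v = core w.
    move=> wv; apply/eqP/negPn/negP => nev; case/negP: nxw; apply: badr.
    by apply/existsP; exists v; rewrite wv.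
  have /existsP[v /andP[bv nev]] := badb b.
  by rewrite (core_communicate_sub wgood wE bv) eqxx in nev.
have Finj : injective F.
  case=> y b [w b'] E.
  case: (boolP (reach x y)) => [xy|nxy]; case: (boolP (reach x w)) => [xw|nxw].
  - have [_ /(_ xy) /= [Fb Fc] _] := FP (y, b).
    have [_ /(_ xw) /= [Fw Fd] _] := FP (w, b').
    rewrite -E in Fw Fd; have [i _] := Fc _ _ Fw; have [j _] := Fd _ _ Fb.
    move: Fw; rewrite -(neb b b' j i) Fb; by case=> ->.
  - by case: (mixed _ _ _ _ xy nxw E).
  - by case: (mixed _ _ _ _ xw nxy (esym E)).
  - have [FS _ /(_ nxy) /= [Fb Fc]] := FP (y, b).
    have [_ _ /(_ nxw) /= [Fw Fd]] := FP (w, b').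
    rewrite -E in Fw Fd; have [_ i] := Fc _ _ Fw; have [_ j] := Fd _ _ Fb.
    have bb := neb b b' j i; rewrite -bb in Fw *.
    by rewrite (Sinj FS Fb Fw).
have <- : #|{: 'I_n * bool}| = 2 * n by rewrite card_prod card_ord card_bool mulnC.
rewrite -(card_codom Finj); apply: subset_leq_card; apply/subsetP => _ /codomP[p ->].
by case: (FP p).
Qed.

(** * Numbering the classes by levels *)

Definition class x := [set y | communicate x y].

(** The classes not reached from [x] are those strictly above it: level 0 is the top, and elements
    of [S] never lower the level number. *)
Definition level x := #|[set class z | z in [pred z | ~~ reach x z]]|.

Definition nlevels := #|[set class z | z : 'I_n]|.

Lemma reach_level x y : reach x y = (level x <= level y).
Proof.
case: (boolP (reach x y)) => [xy|nxy]; apply/esym.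
  apply: subset_leq_card; apply: imsetS; apply/subsetP => z; rewrite !inE.
  by apply: contra; apply: reach_trans.
apply/negbTE; rewrite -ltnNge; apply: proper_card; apply/properP; split.
  apply: imsetS; apply/subsetP => z; rewrite !inE; apply: contra; apply: reach_trans.
  by have := reach_total x y; rewrite (negPf nxy).
exists (class y); first by apply/imsetP; exists y; rewrite ?inE.
apply/negP => /imsetP[z]; rewrite inE => nyz /setP/(_ z).
by rewrite !inE /communicate reach_refl (negPf nyz).
Qed.

Lemma communicate_level x y : communicate x y = (level x == level y).
Proof. by rewrite /communicate !reach_level -eqn_leq. Qed.

Lemma level_lt x : level x < nlevels.
Proof.
apply: proper_card; apply/properP; split.
  by apply/subsetP => _ /imsetP[z _ ->]; apply: imset_f.
exists (class x); first by apply: imset_f.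
apply/negP => /imsetP[z]; rewrite inE => nxz /setP/(_ z).
by rewrite !inE /communicate reach_refl (negPf nxz).
Qed.

Lemma level_onto k : k < nlevels -> exists x, level x = k.
Proof.
move=> km; pose L x := Ordinal (level_lt x).
pose K := [set L x | x : 'I_n].
have KT : K = setT.
  (* A class is determined by its level, so at least [nlevels] levels occur. *)
  apply/eqP; rewrite eqEcard subsetT /= cardsT card_ord.
  pose C (j : 'I_nlevels) := [set y | level y == j].
  apply: leq_trans (leq_imset_card C K); apply: subset_leq_card.
  apply/subsetP => _ /imsetP[z _ ->]; apply/imsetP; exists (L z); first exact: imset_f.
  by apply/setP => y; rewrite !inE communicate_level eq_sym.
have : Ordinal km \in K by rewrite KT inE.
by case/imsetP => x _ [->]; exists x.
Qed.

(** * Groups of permutations of a core *)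

(** The maximal subgroup of [S] at [pid (core x)], pulled back to permutations of all points; their
    values off the core are arbitrary. *)
Definition unit_perms x : {set {perm 'I_n}} :=
  [set s : {perm 'I_n} |
    [forall y in core x, s y \in core x] && (prestr (core x) s \in S)].

Lemma unit_permsP x (s : {perm 'I_n}) : reflect ({in core x, forall y, s y \in core x} /\
  prestr (core x) s \in S) (s \in unit_perms x).
Proof.
rewrite inE; apply: (iffP andP) => -[H ?]; split=> //.
  by move=> y yx; have /forallP/(_ y)/implyP := H; apply.
by apply/forallP => y; apply/implyP; apply: H.
Qed.

Lemma unit_perms_group_set x : group_set (unit_perms x).
Proof.
apply/group_setP; split=> [|s t /unit_permsP[sx sS] /unit_permsP[tx tS]].
  apply/unit_permsP; split=> [y|]; first by rewrite perm1.
  have -> : prestr (core x) 1 = pid (core x).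
    by apply/ffunP => y; rewrite prestrE pidE perm1.
  exact: pid_core.
apply/unit_permsP; split=> [y yx|]; first by rewrite permM tx ?sx.
have -> : prestr (core x) (s * t) = pcomp (prestr (core x) s) (prestr (core x) t).
  apply/ffunP => y; rewrite pcompE !prestrE; case: ifP => //= yx.
  by rewrite prestrE sx // permM.
exact: Smul.
Qed.

Definition unit_group x : {group {perm 'I_n}} := Group (unit_perms_group_set x).

Lemma unit_perm_reach x (s : {perm 'I_n}) y : s \in unit_perms x -> y \in core x -> reach y (s y).
Proof.
by move=> /unit_permsP[_ sS] yx; apply/reachP; exists (prestr (core x) s); rewrite ?prestrE ?yx.
Qed.

Lemma unit_permV x s : s \in unit_perms x -> s^-1%g \in unit_perms x.
Proof. by move=> sG; apply: (groupVr (G := unit_group x)). Qed.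

Lemma unit_perm_level x (s : {perm 'I_n}) y :
  s \in unit_perms x -> y \in core x -> level (s y) = level y.
Proof.
move=> sG yx; have syx : s y \in core x by case/unit_permsP: sG => + _; apply.
apply/eqP; rewrite -communicate_level /communicate (unit_perm_reach sG) // andbT.
by rewrite -{2}(permK s y); exact: (unit_perm_reach (unit_permV sG) syx).
Qed.

Section ConstantCore.

Hypothesis core_const : forall x y, communicate x y -> core y = core x.

Lemma core_level x y : level x = level y -> core x = core y.
Proof. by move=> E; apply/esym/core_const; rewrite communicate_level E. Qed.

Lemma unit_group_orbit x : orbit 'P (unit_group x) x = [set y | level y == level x].
Proof.
apply/setP => y; rewrite inE; apply/orbitP/eqP => [[s sG <-]|E].
  exact: (unit_perm_level sG (core_id x)).
have cxy : core x = core y by apply: core_level.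
have /reachP[f fS fx] : reach x y by rewrite reach_level E.
have yx : reach y x by rewrite reach_level E.
(* [f] maps [core x] injectively into [core y], the same set; the identity extends it to a
   permutation. The default of [odflt] is never taken on the core. *)
pose F w := if w \in core x then odflt w (f w) else w.
have FE w : w \in core x -> f w = Some (F w) /\ F w \in core x.
  move=> wx; have [v [fw vy _]] := recurrent_core fS fx yx wx.
  by rewrite /F wx fw /= cxy.
have Fn w : w \notin core x -> F w = w by rewrite /F => /negPf->.
have Finj : injective F.
  move=> w w' EF.
  case: (boolP (w \in core x)) => wx; case: (boolP (w' \in core x)) => w'x.
  - by apply: (Sinj fS (FE w wx).1); rewrite EF; case: (FE w' w'x).
  - by have [_] := FE w wx; rewrite EF Fn // (negPf w'x).
  - by have [_] := FE w' w'x; rewrite -EF Fn // (negPf wx).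
  - by move: EF; rewrite !Fn.
exists (perm Finj).
  apply/unit_permsP; split=> [w wx|]; first by rewrite permE; case: (FE w wx).
  have -> : prestr (core x) (perm Finj) = pcomp (pid (core x)) f.
    apply/ffunP => w; rewrite prestrE pcompE pidE; case: ifP => //= wx.
    by rewrite permE; case: (FE w wx).
  by rewrite Smul ?pid_core.
by rewrite /= apermE permE; have [+ _] := FE x (core_id x); rewrite fx => -[].
Qed.

(** * Saturating an element under the permutations at both ends *)

Definition level_size k := #|[set y | level y == k]|.

Definition biorbit x y f : {set ptrans n} :=
  [set lperm (rperm f p.2) p.1 | p in setX (unit_perms x) (unit_perms y)].

Section Biorbit.

Variables (f : ptrans n) (x y : 'I_n).
Hypothesis fS : f \in S.
Hypothesis fx : f x = Some y.
Hypothesis f_core : forall w v, f w = Some v -> w \in core x /\ v \in core y.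

Lemma biorbit_id : f \in biorbit x y f.
Proof.
apply/imsetP; exists (1, 1)%g; last by rewrite /= rperm1 lperm1.
by rewrite inE /=; apply/andP; split; apply: (group1 (unit_group _)).
Qed.

Lemma biorbitP g : g \in biorbit x y f -> exists s t,
  [/\ s \in unit_perms x, t \in unit_perms y & forall w, g w = omap t (f (s w))].
Proof.
case/imsetP => -[s t] /setXP[/= sG tG] ->; exists s^-1%g, t.
by split=> // [|w]; [apply: unit_permV | rewrite lpermE rpermE].
Qed.

(** Since [f] only joins [core x] to [core y], acting by permutations of all points amounts to
    multiplying by their restrictions, which lie in [S]. *)
Lemma biorbit_sub : biorbit x y f \subset S.
Proof.
apply/subsetP => g /biorbitP[s [t [sG tG gE]]].
have [sx sS] := unit_permsP _ _ sG; have [ty tS] := unit_permsP _ _ tG.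
have -> : g = pcomp (pcomp (prestr (core x) s) f) (prestr (core y) t).
  apply/ffunP => w; rewrite gE !pcompE prestrE; case: ifP => /= wx.
    by case E: (f (s w)) => [v|] //=; rewrite prestrE; have [_ ->] := f_core E.
  case E: (f (s w)) => [v|] //=; have [swx _] := f_core E.
  have [+ _] := unit_permsP _ _ (unit_permV sG) => /(_ _ swx).
  by rewrite permK wx.
by rewrite !Smul.
Qed.

Lemma biorbit_levels g w v : g \in biorbit x y f -> g w = Some v ->
  exists w' v', [/\ f w' = Some v', level w' = level w & level v' = level v].
Proof.
move=> /biorbitP[s [t [sG tG ->]]]; case E: (f (s w)) => [u|] //= [<-].
have [swx uy] := f_core E; exists (s w), u; split=> //.
  by rewrite -{2}(permK s w) (unit_perm_level (unit_permV sG) swx).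
by rewrite (unit_perm_level tG uy).
Qed.

Lemma biorbit_hit g : g \in biorbit x y f ->
  exists w v, [/\ g w = Some v, level w = level x & level v = level y].
Proof.
move=> /biorbitP[s [t [sG tG gE]]]; exists (s^-1%g x), (t y); split.
- by rewrite gE permKV fx.
- exact: (unit_perm_level (unit_permV sG) (core_id x)).
- exact: (unit_perm_level tG (core_id y)).
Qed.

Lemma biorbit_lperm s g : s \in unit_perms x -> g \in biorbit x y f ->
  lperm g s \in biorbit x y f.
Proof.
move=> sG /imsetP[[s' t] /setXP[/= s'G tG] ->]; rewrite -lpermM.
apply/imsetP; exists (s' * s, t)%g => //; apply/setXP; split=> //=.
exact: (groupM (G := unit_group x)).
Qed.

Lemma biorbit_rperm t g : t \in unit_perms y -> g \in biorbit x y f ->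
  rperm g t \in biorbit x y f.
Proof.
move=> tG /imsetP[[s t'] /setXP[/= sG t'G] ->]; rewrite -lrpermC -rpermM.
apply/imsetP; exists (s, t' * t)%g => //; apply/setXP; split=> //=.
exact: (groupM (G := unit_group y)).
Qed.

(** Each member [g] is defined at some [w] on the level of [x]. By injectivity a permutation that
    fixes [g] fixes [w], and the orbit of [w] is the whole level. *)
Lemma dvdn_biorbit_l : level_size (level x) %| #|biorbit x y f|.
Proof.
rewrite /level_size -unit_group_orbit.
apply: (card_orbit_dvdn (to := lperm_action n)) => [|g gF].
  apply/actsP => s sG g; apply/idP/idP => [H|]; last exact: biorbit_lperm.
  by rewrite -(actK (lperm_action n) s g) /=; apply: biorbit_lperm => //; apply: unit_permV.
have [w [v [gw wx _]]] := biorbit_hit gF.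
exists w; first by rewrite unit_group_orbit inE wx.
apply/subsetP => s /setIP[sG /astab1P /= E]; apply/setIP; split=> //.
apply/astab1P; rewrite /= apermE.
have gS := subsetP biorbit_sub _ gF.
apply: (Sinj gS _ gw); rewrite -E lpermE permK.
exact: gw.
Qed.

(** A permutation that fixes [g] by postcomposition fixes every value of [g], one of which is on the
    level of [y]. *)
Lemma dvdn_biorbit_r : level_size (level y) %| #|biorbit x y f|.
Proof.
rewrite /level_size -unit_group_orbit.
apply: (card_orbit_dvdn (to := rperm_action n)) => [|g gF].
  apply/actsP => s sG g; apply/idP/idP => [H|]; last exact: biorbit_rperm.
  by rewrite -(actK (rperm_action n) s g) /=; apply: biorbit_rperm => //; apply: unit_permV.
have [w [v [gw _ vy]]] := biorbit_hit gF.
exists v; first by rewrite unit_group_orbit inE vy.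
apply/subsetP => s /setIP[sG /astab1P /= E]; apply/setIP; split=> //.
apply/astab1P; rewrite /= apermE.
by have := rpermE g s w; rewrite E gw => -[].
Qed.

End Biorbit.

(** * Words of cores and the elements that carry them *)

(** All cores in the union agree; taking it avoids choosing a representative of the level. *)
Definition level_core k := \bigcup_(x | level x == k) core x.

Lemma level_coreE x : level_core (level x) = core x.
Proof.
apply/eqP; rewrite eqEsubset; apply/andP; split.
  by apply/bigcupsP => y /eqP /core_level ->.
exact: bigcup_sup.
Qed.

Definition has_word i d f :=
  (exists w v, [/\ f w = Some v, level w = i & level v = i + d]) /\
  (forall w v, f w = Some v ->
     exists phi, trajectory level_core i d (level w) (level v) phi).

(** The arrow of [f] spanning each window has a trajectory through the other one, so [trajectory_eq]
    applies. *)
Lemma has_word_inj i d j e f : has_word i d f -> has_word j e f ->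
  d = e /\ forall s, s <= d -> level_core (i + s) = level_core (j + s).
Proof.
move=> [[w [v [fw wi vi]]] tr] [[w' [v' [fw' wj vj]]] tr'].
have [phi] := tr _ _ fw'; have [psi] := tr' _ _ fw.
by rewrite wi vi wj vj => tpsi tphi; apply: trajectory_eq tphi tpsi.
Qed.

(* Otherwise [f] would map [core w] onto [core v] inside the classes, and [x] lies
   in [core w]: it is in its own core, or it is the preimage of [y]. *)
Lemma step_stationary f x y w v : f \in S -> f x = Some y -> level x < level y ->
  f w = Some v -> level w = level v -> core w <> core x /\ core w <> core y.
Proof.
move=> fS fx xy fw wv; have vw : reach v w by rewrite reach_level wv.
split=> E.
  have xw : x \in core w by rewrite E core_id.
  have [u [fu _]] := recurrent_core fS fw vw xw.
  by move: fu; rewrite fx => -[<-]; rewrite reach_level leqNgt xy.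
have cwv := core_level wv.
have yv : y \in core v by rewrite -cwv E core_id.
have [_ onto] := recurrent_image fS fw vw.
have [|u uw fu] := onto _ y yv; first by rewrite cwv.
rewrite -(Sinj fS fx fu) in uw; have [u' [fx' _]] := recurrent_core fS fw vw uw.
by move: fx'; rewrite fx => -[<-]; rewrite reach_level leqNgt xy.
Qed.

(** The element is a product of steps to the next level, each confined to cores, and [phi] records
    the levels of the intermediate points. Confinement gives the core inclusions, and
    [step_stationary] handles stalls. *)
Lemma has_word_exists i d : i + d < nlevels -> exists f x y,
  [/\ f \in S, f x = Some y, level x = i, level y = i + d &
      forall w v, f w = Some v -> [/\ w \in core x, v \in core y &
        exists phi, trajectory level_core i d (level w) (level v) phi]].
Proof.
elim: d => [|d IH] lt_id.
  have [x xi] := level_onto (leq_ltn_trans (leq_addr 0 i) lt_id).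
  exists (pid (core x)), x, x; split; rewrite ?addn0 ?pid_core //.
    by apply/pid_SomeP; rewrite core_id.
  move=> w v /pid_SomeP[wx ->]; split=> //; exists (fun=> level w); split=> // s.
  by rewrite leqn0 => /eqP->; rewrite addn0 -xi !level_coreE core_sub.
have [|f [x [y [fS fx xi yi fP]]]] := IH; first by apply: leq_ltn_trans lt_id; lia.
have [y' y'i] := level_onto lt_id.
have lt_yy' : level y < level y' by lia.
have [g [gS gy gc]] : exists g, [/\ g \in S, g y = Some y' &
    forall w v, g w = Some v -> w \in core y /\ v \in core y'].
  by apply: reach_core; rewrite reach_level ltnW.
exists (pcomp f g), x, y'; split=> //; first exact: Smul.
  by apply/pcomp_SomeP; exists y.
move=> w v /pcomp_SomeP[u fw gu]; have [wx uy [phi tphi]] := fP _ _ fw.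
have [_ vy'] := gc _ _ gu; split=> //.
have [phi0 phid phim phiA phis] := tphi.
exists (fun s => if s <= d then phi s else level v); split=> //.
- by rewrite ltnn.
- move=> s /=; rewrite ltnS => le_sd; rewrite le_sd; move: le_sd.
  rewrite leq_eqVlt => /orP[/eqP->|sd].
    by rewrite ltnn phid -reach_level; apply/reachP; exists g.
  by rewrite sd; apply: phim.
- move=> s /=; rewrite leq_eqVlt => /orP[/eqP->|sd].
    by rewrite ltnn -y'i !level_coreE core_sub.
  by rewrite -ltnS sd; apply: phiA.
move=> s /=; rewrite ltnS => le_sd; rewrite le_sd; move: le_sd.
rewrite leq_eqVlt => /orP[/eqP->|sd].
  rewrite ltnn phid => uv.
  rewrite -yi -y'i !level_coreE.
  exact: (step_stationary gS gy lt_yy' gu uv).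
by rewrite sd; apply: phis.
Qed.

(** Saturation preserves the levels joined by arrows, so the whole biorbit keeps the word. *)
Lemma window_exists i d : i + d < nlevels -> exists F : {set ptrans n},
  [/\ F \subset S, 0 < #|F|, level_size i %| #|F|, level_size (i + d) %| #|F|
    & forall f, f \in F -> has_word i d f].
Proof.
move=> /has_word_exists[f [x [y [fS fx xi yi fP]]]].
have fc w v : f w = Some v -> w \in core x /\ v \in core y by case/fP.
exists (biorbit x y f); split.
- exact: biorbit_sub.
- by apply/card_gt0P; exists f; apply: biorbit_id.
- by rewrite -xi; apply: dvdn_biorbit_l.
- by rewrite -yi; apply: dvdn_biorbit_r.
move=> g gF; split.
  by have [w [v [gw wx vy]]] := biorbit_hit fx gF; exists w, v; rewrite gw wx vy xi yi.
move=> w v gw; have [w' [v' [fw' <- <-]]] := biorbit_levels fc gF gw.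
by case/fP: fw'.
Qed.

(** * Growing a segment of levels and counting *)

Lemma level_size_gt0 k : k < nlevels -> 0 < level_size k.
Proof. by move=> /level_onto[x xk]; apply/card_gt0P; exists x; rewrite inE xk. Qed.

Lemma sum_level_size : \sum_(0 <= k < nlevels) level_size k = n.
Proof.
rewrite big_mkord -[RHS]card_ord -sum1_card.
rewrite (partition_big (fun x => Ordinal (level_lt x)) predT) //=.
apply: eq_bigr => k _; rewrite /level_size -sum1_card.
by apply: eq_bigl => x; rewrite inE.
Qed.

(** The clause on words keeps new windows disjoint from [U]: length [q.+1] is too long, and a window
    of length [q] can only clash with the word starting at [l]. *)
Definition segment_bound l q := exists (U : {set ptrans n}) (g : nat),
  [/\ U \subset S,
      forall f, f \in U -> exists i d, [/\ has_word i d f, d <= q & d = q -> i = l],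
      forall k, l <= k <= l + q -> g %| level_size k
    & 2 * \sum_(l <= k < l + q.+1) level_size k <= #|U| + g].

(* The sizes of the two new windows are common multiples of the new class size
   and of [g], so they pay for twice that size and for the drop of [g]. *)
Lemma segment_extend l q l' a k : segment_bound l q ->
  l' + q.+1 < nlevels -> a + q < nlevels ->
  (l' = k \/ l' + q.+1 = k) -> (a = k \/ a + q = k) ->
  (l <= l' <= l + q \/ l <= l' + q.+1 <= l + q) ->
  (l <= a <= l + q \/ l <= a + q <= l + q) ->
  (exists2 s, s <= q & level_core (a + s) <> level_core (l + s)) ->
  (forall j, l' <= j <= l' + q.+1 -> j = k \/ l <= j <= l + q) ->
  \sum_(l' <= j < l' + q.+2) level_size j =
    level_size k + \sum_(l <= j < l + q.+1) level_size j ->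
  segment_bound l' q.+1.
Proof.
move=> [U [g [US Uw Ug Ub]]] lt1 lt2 k1 k2 o1 o2 [s sq nes] cov sumE.
have [F1 [F1S F1n F1l F1r F1w]] := window_exists lt1.
have [F2 [F2S F2n F2l F2r F2w]] := window_exists lt2.
have dF1 : level_size k %| #|F1| by case: k1 => <-.
have dF2 : level_size k %| #|F2| by case: k2 => <-.
have gF1 : g %| #|F1| by case: o1 => /Ug H; apply: dvdn_trans H _.
have gF2 : g %| #|F2| by case: o2 => /Ug H; apply: dvdn_trans H _.
have dis1 : [disjoint F1 & F2].
  apply/pred0P => f /=; apply/negP => /andP[/F1w h1 /F2w h2].
  by have [/esym/n_Sn] := has_word_inj h1 h2.
have dis2 : [disjoint F1 :|: F2 & U].
  apply/pred0P => f /=; apply/negP => /andP[+ /Uw[i [d [h3 dq di]]]].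
  case/setUP => [/F1w h1|/F2w h2].
    by have [E _] := has_word_inj h1 h3; rewrite -E ltnn in dq.
  have [E eqs] := has_word_inj h2 h3.
  by case: nes; rewrite eqs // di.
exists ((F1 :|: F2) :|: U), (gcdn (level_size k) g); split.
- by rewrite !subUset F1S F2S.
- move=> f /setUP[/setUP[/F1w h|/F2w h]|/Uw[i [d [h dq _]]]].
  + by exists l', q.+1.
  + by exists a, q; split=> // /n_Sn.
  + exists i, d; split=> //; first exact: leqW.
    by move=> E; rewrite E ltnn in dq.
- move=> j /cov[->|/Ug]; first exact: dvdn_gcdl.
  by apply: dvdn_trans; apply: dvdn_gcdr.
rewrite sumE.
have -> : #|F1 :|: F2 :|: U| = #|F1| + #|F2| + #|U|.
  by rewrite (eqTleqif (leq_card_setU _ _) dis2) (eqTleqif (leq_card_setU _ _) dis1).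
by move: (common_multiples_gcd_ge F1n F2n dF1 dF2 gF1 gF2) Ub; clear; lia.
Qed.

(** Two windows of length 0, distinct because the cores differ, pay for the two sizes once; the
    window of length 1 pays for them again up to the gcd. *)
Lemma segment_base c : c.+1 < nlevels -> level_core c <> level_core c.+1 ->
  segment_bound c 1.
Proof.
move=> lt_c ne.
have [|F1 [F1S F1n F1l _ F1w]] := @window_exists c 0; first by rewrite addn0 ltnW.
have [|F2 [F2S F2n F2l _ F2w]] := @window_exists c.+1 0; first by rewrite addn0.
have [|F [FS Fn Fl Fr Fw]] := @window_exists c 1; first by rewrite addn1.
rewrite addn1 in Fr.
have dis1 : [disjoint F1 & F2].
  apply/pred0P => f /=; apply/negP => /andP[/F1w h1 /F2w h2].
  by have [_ /(_ 0 (leqnn 0))] := has_word_inj h1 h2; rewrite !addn0.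
have dis2 : [disjoint F1 :|: F2 & F].
  apply/pred0P => f /=; apply/negP => /andP[+ /Fw h].
  by case/setUP => [/F1w h1|/F2w h2];
    [have [] := has_word_inj h1 h | have [] := has_word_inj h2 h].
exists ((F1 :|: F2) :|: F), (gcdn (level_size c) (level_size c.+1)); split.
- by rewrite !subUset F1S F2S.
- move=> f /setUP[/setUP[/F1w h|/F2w h]|/Fw h].
  + by exists c, 0.
  + by exists c.+1, 0.
  + by exists c, 1.
- move=> k kc; have [->|->] : k = c \/ k = c.+1 by lia.
    exact: dvdn_gcdl.
  exact: dvdn_gcdr.
have -> : \sum_(c <= k < c + 2) level_size k = level_size c + level_size c.+1.
  by rewrite addn2 big_ltn // big_nat1.
have -> : #|F1 :|: F2 :|: F| = #|F1| + #|F2| + #|F|.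
  by rewrite (eqTleqif (leq_card_setU _ _) dis2) (eqTleqif (leq_card_setU _ _) dis1).
move: (dvdn_leq F1n F1l) (dvdn_leq F2n F2l) (common_multiple_gcd_ge Fn Fl Fr).
by clear; lia.
Qed.

(** The new windows end at [l + q.+1] and start at [l] and [l.+1]. The shorter one differs from the
    window of length [q] at [l] in position [c - l], where [c.+1] is compared with [c]. *)
Lemma segment_right c l q : level_core c <> level_core c.+1 -> l <= c < l + q ->
  l + q.+1 < nlevels -> segment_bound l q -> segment_bound l q.+1.
Proof.
move=> ne cq lt_m sb.
apply: (segment_extend (a := l.+1) (k := l + q.+1) sb); try lia.
  exists (c - l); first lia.
  have -> : l.+1 + (c - l) = c.+1 by lia.
  have -> : l + (c - l) = c by lia.
  exact: nesym.
by rewrite [l + q.+2]addnS big_nat_recr ?leq_addr //= addnC.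
Qed.

Lemma segment_left c l q : level_core c <> level_core c.+1 -> l < c <= l + q ->
  l + q.+1 < nlevels -> segment_bound l.+1 q -> segment_bound l q.+1.
Proof.
move=> ne cq lt_m sb.
apply: (segment_extend (a := l) (k := l) sb); try lia.
  exists (c - l); first lia.
  have -> : l.+1 + (c - l) = c.+1 by lia.
  by have -> : l + (c - l) = c by lia.
by rewrite big_ltn ?addSnnS //; lia.
Qed.

(** A core common to all levels would contain every point, putting the full identity into [S]. *)
Lemma core_break (x0 : 'I_n) : exists2 c, c.+1 < nlevels & level_core c <> level_core c.+1.
Proof.
have [ex|nex] := boolP
    [exists c : 'I_nlevels, (c.+1 < nlevels) && (level_core c != level_core c.+1)].
  by have /existsP[c /andP[lt_c /eqP ne]] := ex; exists c.
have step c : c.+1 < nlevels -> level_core c.+1 = level_core c.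
  move=> lt_c; apply/esym/eqP; apply: contraNT nex => ne.
  by apply/existsP; exists (Ordinal (ltnW lt_c)); rewrite /= lt_c.
have const c : c < nlevels -> level_core c = level_core 0.
  by elim: c => // c IH lt_c; rewrite step // IH // ltnW.
case/negP: pid_setT_notin.
have [x xl] := level_onto (leq_ltn_trans (leq0n _) (level_lt x0)).
have <- : core x = setT.
  apply/setP => y; rewrite in_setT -level_coreE xl -(const (level y)) ?level_lt //.
  by rewrite level_coreE core_id.
exact: pid_core.
Qed.

Lemma card_core_constant : 1 < n -> 2 * n - greatest_proper_divisor n + 1 <= #|S|.
Proof.
move=> n_gt1; have [c lt_c ne] := core_break (Ordinal n_gt1).
have grow_right q : c + q.+1 < nlevels -> segment_bound c q.+1.
  elim: q => [|q IH] lt_q; first exact: segment_base.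
  by apply: (segment_right ne) => //; [lia | apply: IH; lia].
have grow_left : forall k, k <= c -> segment_bound (c - k) (nlevels.-1 - (c - k)).
  elim=> [|k IH] kc.
    rewrite subn0; have -> : nlevels.-1 - c = (nlevels.-1 - c).-1.+1 by lia.
    by apply: grow_right; lia.
  have -> : nlevels.-1 - (c - k.+1) = (nlevels.-1 - (c - k)).+1 by lia.
  apply: (segment_left ne); try lia.
  have -> : (c - k.+1).+1 = c - k by lia.
  by apply: IH; lia.
have := grow_left c (leqnn c); rewrite subnn subn0 => -[U [g [US Uw Ug Ub]]].
have E : 0 + nlevels.-1.+1 = nlevels by lia.
rewrite E sum_level_size in Ub.
have gn : g %| n.
  rewrite -[n]sum_level_size big_mkord.
  apply: (big_ind (fun k => g %| k)) => [|a b|k _]; [exact: dvdn0|exact: dvdn_add|].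
  by apply: Ug; have := ltn_ord k; lia.
(* [g] is at most the size of level 0, and level 1 is nonempty. *)
have g_lt : g < n.
  have s0 : 0 < level_size 0 by apply: level_size_gt0; lia.
  have s1 : 0 < level_size 1 by apply: level_size_gt0; lia.
  have g0 : g <= level_size 0 by apply: dvdn_leq => //; apply: Ug.
  have := sum_level_size; rewrite big_ltn; last by lia.
  rewrite big_ltn; last by lia.
  by lia.
have g_le : g <= greatest_proper_divisor n.
  exact: (leq_bigmax_cond (Ordinal g_lt) gn).
(* Elements of [U] join at least one pair of points, so the empty map is extra. *)
have zU : pid set0 \notin U.
  apply/negP => /Uw[i [d [[[w [v [+ _ _]]] _] _ _]]].
  by rewrite pidE inE.
have : #|pid set0 |: U| <= #|S|.
  by apply: subset_leq_card; rewrite subUset US sub1set pid0_in.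
rewrite cardsU1 zU add1n addn1; apply: leq_trans; rewrite ltnS leq_subLR addnC.
by apply: leq_trans Ub _; rewrite leq_add2l.
Qed.

End ConstantCore.

End Semigroup.

Theorem theorem3p5 (n : nat) (S : {set ptrans n}) :
  2 <= n -> subsemigroup_of_noninv S -> semitransitive S ->
  2 * n - greatest_proper_divisor n + 1 <= #|S|.
Proof.
move=> n_gt1 Ssg Sst.
have [/existsP[x /existsP[y /andP[xy ne]]]|all_eq] :=
    boolP [exists x, exists y, communicate S x y && (core S y != core S x)].
  (* With [1] as a proper divisor, the bound [2 * n] of this case suffices. *)
  have p_gt0 : 0 < greatest_proper_divisor n.
    exact: (leq_bigmax_cond (Ordinal n_gt1) (dvd1n n)).
  by have := card_core_nonconstant Ssg Sst xy ne; lia.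
apply: card_core_constant => // x y xy; apply/eqP; apply: contraNT all_eq => ne.
by apply/existsP; exists x; apply/existsP; exists y; rewrite xy.
Qed.
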